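(* Let $K$ be a field and let $I\subset K[x,y]$ be a concave monomial ideal of height $2$ with minimal monomial generators $u_1>u_2>\cdots>u_m$ (lexicographic order). Then: (a) $I^k=J^{k-1}I=JI^{k-1}$ for all $k\ge 2$, where $J=(u_1,u_m)$. (b) $\mu(I^k)=(m-1)k+1$ for all $k\ge 0$. In particular, $\mathrm{Hilb}_{F(I)}(t)=(1+(m-2)t)/(1-t)^2$.
   Context: $\mathfrak m=(x,y)\subset K[x,y]$. For a monomial ideal $I\subset K[x,y]$ of height $2$, $G(I)=\{u_1,\ldots,u_m\}$ is its unique minimal set of monomial generators, labeled so that $u_1>\cdots>u_m$ lexicographically (with $x>y$). Writing $u_i=x^{a_i}y^{b_i}$, one has $a_1>\cdots>a_m=0$ and $0=b_1<\cdots<b_m$ (so $m\ge2$). The exponent vector of $u_i$ is $\mathbf c_i=(a_i,b_i)$. For integer vectors $\le$ is componentwise. The ideal $I$ is concave if $2\mathbf c_i\ge\mathbf c_{i-1}+\mathbf c_{i+1}$ for $i=2,\ldots,m-1$. $\mu(I)$ is the minimal number of generators of $I$. The fiber cone is $F(I)=\bigoplus_{k\ge0}I^k/\mathfrak mI^k$, so $\dim_KF(I)_k=\mu(I^k)$, and $\mathrm{Hilb}_{F(I)}(t)=\sum_{k\ge0}\dim_KF(I)_k\,t^k$. *)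

(* Defs.v *)
(* K[x, y] is {mpoly K[2]}: x is 'X_0, y is 'X_1, and x^a y^b is 'X_[c] with
   c = (a, b) : 'X_{1..2}. *)
From HB Require Import structures.
From mathcomp Require Import all_boot all_order all_algebra.
From mathcomp.multinomials Require Export mpoly.
Set Implicit Arguments.
Unset Strict Implicit.
Unset Printing Implicit Defensive.
Import GRing.Theory.
Local Open Scope ring_scope.

(* The [idealr] structure of MathComp is boolean and restricted to proper
   ideals, which excludes I^0 = R; ideals are Prop-valued predicates here. *)
Section Ideals.
Variable R : comNzRingType.
Implicit Types (S I J P : R -> Prop) (k n : nat).

Definition is_ideal I : Prop :=
  I 0 /\ forall a f g, I f -> I g -> I (a * f + g).

Definition same_ideal I J : Prop := forall f, I f <-> J f.

Definition ideal_incl I J : Prop := forall f, I f -> J f.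

Definition ideal_gen S : R -> Prop := fun f =>
  exists n (a s : 'I_n -> R), (forall i, S (s i)) /\ f = \sum_i a i * s i.

Definition ideal_mul I J : R -> Prop :=
  ideal_gen (fun h => exists f g, I f /\ J g /\ h = f * g).

Definition ideal_exp I k : R -> Prop := iter k (ideal_mul I) (fun=> True).

Definition is_mu I n : Prop :=
  (exists2 g : seq R, size g = n & same_ideal (ideal_gen (fun f => f \in g)) I)
  /\ forall g : seq R,
       same_ideal (ideal_gen (fun f => f \in g)) I -> (n <= size g)%N.

Definition prime_ideal P : Prop :=
  [/\ is_ideal P, ~ P 1 & forall f g, P (f * g) -> P f \/ P g].

Definition prime_height_ge P n : Prop :=
  exists Q : nat -> R -> Prop,
    [/\ forall i, (i <= n)%N -> prime_ideal (Q i),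
        forall i, (i < n)%N ->
          ideal_incl (Q i) (Q i.+1) /\ ~ ideal_incl (Q i.+1) (Q i)
      & same_ideal (Q n) P].

(* The height of I is the least height of a prime containing I; in particular
   the unit ideal has no (finite) height. *)
Definition has_height I n : Prop :=
  (forall P, prime_ideal P -> ideal_incl I P -> prime_height_ge P n) /\
  (exists P, [/\ prime_ideal P, ideal_incl I P & ~ prime_height_ge P n.+1]).

End Ideals.

(* dim_K (V / W) = d, for subspaces W of V given as predicates on L. *)
Definition is_dim_quot (K : fieldType) (L : lmodType K) (V W : L -> Prop)
    (d : nat) : Prop :=
  exists v : 'I_d -> L,
    [/\ forall i, V (v i),
        forall f, V f -> exists c : 'I_d -> K, W (f - \sum_i c i *: v i)
      & forall c : 'I_d -> K, W (\sum_i c i *: v i) -> forall i, c i = 0].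

Section Monomials.
Variables (n : nat) (K : fieldType).
Implicit Types (u v : seq 'X_{1..n}) (I : {mpoly K[n]} -> Prop).

Definition monom_gen (S : 'X_{1..n} -> Prop) : {mpoly K[n]} -> Prop :=
  ideal_gen (fun f => exists2 c, S c & f = 'X_[c]).

Definition monomial_ideal I : Prop :=
  exists S : 'X_{1..n} -> Prop, same_ideal I (monom_gen S).

Definition min_monom_gens I u : Prop :=
  same_ideal I (monom_gen (fun c => c \in u)) /\
  forall v, {subset v <= u} ->
    same_ideal I (monom_gen (fun c => c \in v)) -> {subset u <= v}.

(* c > d in the pure lexicographic order with 'X_0 > 'X_1 > ...; the order
   that [mpoly] puts on monomials compares total degrees first. *)
Definition lex_gt (c d : 'X_{1..n}) : bool :=
  [exists i : 'I_n, (d i < c i)%N &&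
    [forall j : 'I_n, (j < i)%N ==> (c j == d j)]].

Definition is_G I u : Prop := min_monom_gens I u /\ sorted lex_gt u.

Definition max_graded : {mpoly K[n]} -> Prop :=
  ideal_gen (fun f => exists i : 'I_n, f = 'X_i).

(* H k = dim_K F(I)_k, where F(I)_k = I^k / m I^k. *)
Definition is_fiber_Hilbert_fun I (H : nat -> nat) : Prop :=
  forall k, is_dim_quot (ideal_exp I k)
                        (ideal_mul max_graded (ideal_exp I k)) (H k).

End Monomials.

(* The formal power series sum_k H(k) t^k equals p / q in Z[[t]]: its Cauchy
   product with q is p. Meant for q with constant term 1. *)
Definition series_eq_frac (H : nat -> int) (p q : {poly int}) : Prop :=
  forall k : nat, \sum_(i < k.+1) H i * q`_(k - i) = p`_k.

Definition concave (u : seq 'X_{1..2}) : Prop :=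
  forall i, (i.+2 < size u)%N ->
    (nth 0 u i + nth 0 u i.+2 <= nth 0 u i.+1 *+ 2)%MM.

(* Main.v *)
Require Import Defs.
From mathcomp Require Import all_boot all_order all_algebra.
From mathcomp.multinomials Require Import mpoly.
From mathcomp Require Import zify ring.
Set Implicit Arguments.
Unset Strict Implicit.
Unset Printing Implicit Defensive.
Import GRing.Theory.
Local Open Scope ring_scope.

(** Write [N = m - 1] and let [c 0, ..., c N] be the exponents of the minimal
    generators. Concavity says that each coordinate of [c] is a concave
    sequence, and a concave sequence takes a larger total on a pair of indices
    than on any wider pair with the same sum ([concave_exchange]). Widening
    the pair [(i, j)] until it hits an end of [0 .. N] gives
      [c i + c j >= c 0 + c (i + j)]        if [i + j <= N],
      [c i + c j >= c N + c (i + j - N)]    if [i + j >= N],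
    so that every product of two generators lies in [J I]: this is
    [I^2 = J I], and (a) follows.

    For (b), [I^k = J^(k-1) I] is generated by the monomials whose exponents
    are sums of [k - 1] copies of [c 0] or [c N] and one [c i]. Among them, the
    path [stair k] which goes from [k c 0] to [k c N] by following [c] from
    [c 0] to [c N], [k] times in succession, already generates: replacing a
    sum of two exponents by a smaller one through the inequalities above keeps
    the sum of the indices, so [c i + stair k s >= stair (k + 1) (i + s)]
    ([stair_le_add], [stairs_mul]). The path has [N k + 1] points; its first
    coordinate strictly decreases and its second strictly increases, because
    those of [c] do, so its points are pairwise incomparable
    ([stair_antichain]).

    Finally, the monomials of an antichain form a minimal generating set of
    the ideal they generate, whatever polynomial generators are allowed. The
    point is [coefsM]: on that ideal, the vector of coefficients at the
    antichain transforms under multiplication by [h] only through the constant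
    term of [h]. Hence this vector identifies the quotient of the ideal
    by its product with the maximal ideal with a coordinate space
    ([antichain_dim_quot]), and the coefficient vectors of any generating
    family span that space ([antichain_mu]). *)

(** * Concave sequences *)

(** The increments of a concave sequence are nonincreasing. *)
Lemma concave_increment (f : nat -> nat) (N i d : nat) :
    (forall j, (j.+2 <= N)%N -> (f j + f j.+2 <= (f j.+1).*2)%N) ->
  (i + d < N)%N -> (f i + f (i + d).+1 <= f i.+1 + f (i + d))%N.
Proof.
move=> fC; elim: d => [|d IHd] lt_N; first by rewrite addn0 addnC.
rewrite addnS in lt_N *.
by have := fC _ lt_N; have := IHd (ltnW lt_N); lia.
Qed.

(** Each of the [d] increments from [p] on is at least the one [q - p] places
    further; summing them compares the pair [(p + d, q)] with the wider pair
    [(p, q + d)]. *)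
Lemma concave_exchange (f : nat -> nat) (N p q d : nat) :
    (forall j, (j.+2 <= N)%N -> (f j + f j.+2 <= (f j.+1).*2)%N) ->
  (p <= q)%N -> (q + d <= N)%N -> (f p + f (q + d) <= f (p + d) + f q)%N.
Proof.
move=> fC le_pq; elim: d => [|d IHd] le_N; first by rewrite !addn0.
have := @concave_increment f N (p + d) (q - p) fC.
have -> : (p + d + (q - p) = q + d)%N by lia.
by rewrite !addnS in le_N * => /(_ le_N); have := IHd (ltnW le_N); lia.
Qed.

(** * The staircase path of a sequence of exponents *)

Section Staircase.
Variables (n : nat) (c : nat -> 'X_{1..n}) (N : nat).

(** The path that follows [c] from index [0] to [N], [k] times in succession,
    each new round starting from [c N] instead of [c 0] in one more summand.
    Index [N] could be put in either branch, since the two agree there; this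
    is what makes [stair_shift] hold without a side condition. *)
Fixpoint stair (k s : nat) : 'X_{1..n} :=
  if k is k'.+1 then
    if (s <= N)%N then (c s + c 0 *+ k')%MM else (c N + stair k' (s - N))%MM
  else 0%MM.

Definition stairs (k : nat) (d : 'X_{1..n}) : Prop :=
  exists2 s, (s <= N * k)%N & d = stair k s.

Lemma stair0 k : stair k 0 = (c 0 *+ k)%MM.
Proof. by case: k => [|k] /=; rewrite ?mulm0n // mulmS. Qed.

Lemma stair_init k s : (s <= N)%N -> stair k.+1 s = (c s + c 0 *+ k)%MM.
Proof. by move=> /= ->. Qed.

Lemma stair_shift k s : stair k.+1 (N + s) = (c N + stair k s)%MM.
Proof.
case: s => [|s]; first by rewrite addn0 /= leqnn stair0.
by rewrite /= leqNgt addnS ltnS leq_addr /= -addnS addKn.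
Qed.

(** One step of the path changes a single summand [c j] into [c j.+1], whence
    the translation-invariant relation [r]; it is used both for [<] and
    for [>]. *)
Lemma stair_step (r : rel nat) (i : 'I_n) k s :
    (forall a b d, r a b -> r (d + a)%N (d + b)%N) ->
    (forall j, (j < N)%N -> r (c j i) (c j.+1 i)) ->
  (s < N * k)%N -> r (stair k s i) (stair k s.+1 i).
Proof.
move=> rD rc; elim: k s => [|k IHk] s; first by rewrite muln0.
rewrite mulnS => lt_s; have [lt_sN | le_Ns] := ltnP s N.
  rewrite !stair_init ?(ltnW lt_sN) // !mnmDE ![(_ + (c 0 *+ k)%MM i)%N]addnC.
  exact/rD/rc.
rewrite -(subnKC le_Ns) -addnS !stair_shift !mnmDE; apply/rD/IHk; lia.
Qed.

Lemma stair_homo (r : rel nat) (i : 'I_n) k s t :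
    transitive r -> (forall a b d, r a b -> r (d + a)%N (d + b)%N) ->
    (forall j, (j < N)%N -> r (c j i) (c j.+1 i)) ->
  (s < t)%N -> (t <= N * k)%N -> r (stair k s i) (stair k t i).
Proof.
move=> r_trans rD rc; elim: t => // t IHt.
rewrite ltnS leq_eqVlt => /predU1P[->|lt_st] le_t.
  exact: stair_step.
exact: r_trans (IHt lt_st (ltnW le_t)) (stair_step rD rc le_t).
Qed.

(** Along the path one coordinate strictly decreases and another strictly
    increases, so neither of two distinct points can dominate the other. *)
Lemma stair_antichain (i j : 'I_n) k s t :
    (forall l, (l < N)%N -> (c l.+1 i < c l i)%N) ->
    (forall l, (l < N)%N -> (c l j < c l.+1 j)%N) ->
    (s <= N * k)%N -> (t <= N * k)%N -> (stair k s <= stair k t)%MM ->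
  s = t.
Proof.
move=> decr incr le_s le_t /mnm_lepP le_st; case: (ltngtP s t) => // lt_st.
- have: (stair k s i > stair k t i)%N.
    apply: (@stair_homo gtn) => //; [move=> b a d; lia | move=> a b d /=; lia].
  by rewrite ltnNge le_st.
- have: (stair k t j < stair k s j)%N.
    apply: (@stair_homo ltn) => //; [exact: ltn_trans | move=> a b d /=; lia].
  by rewrite ltnNge le_st.
Qed.

Hypothesis c_concave :
  forall i, (i.+2 <= N)%N -> (c i + c i.+2 <= c i.+1 *+ 2)%MM.

Lemma concave_exchange_mnm p q d : (p <= q)%N -> (q + d <= N)%N ->
  (c p + c (q + d)%N <= c (p + d)%N + c q)%MM.
Proof.
move=> le_pq le_N; apply/mnm_lepP => i; rewrite !mnmDE.
apply: (@concave_exchange (fun s => c s i) N) => // j /c_concave/mnm_lepP/(_ i).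
by rewrite mnmDE mulmnE muln2.
Qed.

(** At most one summand of [stair k s] is not an end of [c]. Exchanging it with
    [c i] as far as possible gives [c 0] or [c N] plus a single term; in the
    second case the path has moved on to its next round. *)
Lemma stair_le_add k i s : (i <= N)%N -> (s <= N * k)%N ->
  (stair k.+1 (i + s) <= c i + stair k s)%MM.
Proof.
elim: k s => [|k IHk] s le_i le_s.
  have ->: s = 0%N by lia.
  by rewrite addn0 stair_init // mulm0n lepm_refl.
have [le_sN | lt_Ns] := leqP s N; last first.
  rewrite -{2}(subnKC (ltnW lt_Ns)) stair_shift.
  have -> : (i + s = N + (i + (s - N)))%N by lia.
  rewrite stair_shift addmA [(c i + _)%MM]addmC -addmA.
  apply/mnm_lepP => l; rewrite !(mnmDE l (c N)) leq_add2l.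
  by apply/mnm_lepP/IHk => //; rewrite mulnS in le_s; lia.
(* Now [stair k.+1 s] is [c s] plus copies of [c 0], so [c i + c s] is the
   pair to be exchanged. *)
rewrite (stair_init k le_sN).
have [le_is | lt_N] := leqP (i + s) N.
  rewrite stair_init // mulmS !addmA; apply/mnm_lepP => l.
  rewrite !(mnmDE l _ (c 0 *+ k)%MM) leq_add2r; apply/mnm_lepP.
  have := @concave_exchange_mnm 0 i s; rewrite add0n [(c s + _)%MM]addmC.
  by rewrite [(c 0 + _)%MM]addmC; exact.
have -> : (i + s = N + (i + s - N))%N by lia.
rewrite stair_shift stair_init; last by lia.
rewrite !addmA; apply/mnm_lepP => l.
rewrite !(mnmDE l _ (c 0 *+ k)%MM) leq_add2r; apply/mnm_lepP.
have := @concave_exchange_mnm (i + s - N) s (N - s).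
have -> : (i + s - N + (N - s) = i)%N by lia.
have -> : (s + (N - s) = N)%N by lia.
by rewrite addmC; apply; lia.
Qed.

End Staircase.

(** * Ideals *)
Section IdealAlgebra.
Variable R : comNzRingType.
Implicit Types (S T I J P : R -> Prop).

Lemma same_ideal_refl I : same_ideal I I.
Proof. by []. Qed.

Lemma same_ideal_sym I J : same_ideal I J -> same_ideal J I.
Proof. by move=> IJ f; split=> /IJ. Qed.

Lemma same_ideal_trans J I P :
  same_ideal I J -> same_ideal J P -> same_ideal I P.
Proof. by move=> IJ JP f; split=> [/IJ/JP | /JP/IJ]. Qed.

Lemma ideal_gen_min S P :
  is_ideal P -> ideal_incl S P -> ideal_incl (ideal_gen S) P.
Proof.
move=> [P0 PD] SP _ [n [a [s [Ss ->]]]]; elim/big_ind: _ => //.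
- by move=> f g Pf Pg; rewrite -[f]mul1r; apply: PD.
- by move=> i _; rewrite -[_ * _]addr0; apply: PD => //; apply/SP/Ss.
Qed.

Lemma mem_ideal_gen S f : S f -> ideal_gen S f.
Proof.
by move=> Sf; exists 1%N, (fun=> 1), (fun=> f); rewrite big_ord1 mul1r.
Qed.

Lemma ideal_gen_ideal S : is_ideal (ideal_gen S).
Proof.
split=> [|a f g [p [b [s [Ss ->]]]] [q [d [t [Tt ->]]]]].
  by exists 0%N, (fun=> 0), (fun=> 0); split=> [[]|] //; rewrite big_ord0.
exists (p + q)%N.
exists (fun i => match split i with inl j => a * b j | inr j => d j end).
exists (fun i => match split i with inl j => s j | inr j => t j end).
split=> [i|]; first by case: (split i).
rewrite big_split_ord /= mulr_sumr; congr (_ + _); apply: eq_bigr => i _.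
  by rewrite -[lshift q i]/(unsplit (inl i)) unsplitK mulrA.
by rewrite -[rshift p i]/(unsplit (inr i)) unsplitK.
Qed.

Lemma ideal_gen_incl S T :
  ideal_incl S (ideal_gen T) -> ideal_incl (ideal_gen S) (ideal_gen T).
Proof. by apply: ideal_gen_min; apply: ideal_gen_ideal. Qed.

Lemma ideal_gen_same S T :
  (forall f, S f <-> T f) -> same_ideal (ideal_gen S) (ideal_gen T).
Proof.
by move=> ST f; split; apply: ideal_gen_incl => g /ST; apply: mem_ideal_gen.
Qed.

Lemma ideal_sum I (A : Type) (r : seq A) (F : A -> R) :
  is_ideal I -> (forall i, I (F i)) -> I (\sum_(i <- r) F i).
Proof.
move=> [I0 ID] IF; elim/big_ind: _ => // f g If Ig.
by rewrite -[f]mul1r; apply: ID.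
Qed.

Lemma ideal_mull I a f : is_ideal I -> I f -> I (a * f).
Proof. by move=> [I0 ID] If; rewrite -[_ * _]addr0; apply: ID. Qed.

Lemma ideal_mul_mem I J f g : I f -> J g -> ideal_mul I J (f * g).
Proof. by move=> If Jg; apply: mem_ideal_gen; exists f, g. Qed.

Lemma ideal_mul_incl I J P :
    is_ideal P -> (forall f g, I f -> J g -> P (f * g)) ->
  ideal_incl (ideal_mul I J) P.
Proof.
move=> idP IJP; apply: ideal_gen_min => // _ [f [g [If [Jg ->]]]].
exact: IJP.
Qed.

Lemma ideal_mul_same I I' J J' :
    same_ideal I I' -> same_ideal J J' ->
  same_ideal (ideal_mul I J) (ideal_mul I' J').
Proof.
move=> II' JJ'; apply: ideal_gen_same => h.
by split=> -[f [g [/II' If [/JJ' Jg ->]]]]; exists f, g.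
Qed.

Lemma ideal_mulC I J : same_ideal (ideal_mul I J) (ideal_mul J I).
Proof.
by move=> h; apply: ideal_gen_same => p; split=> -[f [g [If [Jg ->]]]];
   exists g, f; rewrite mulrC.
Qed.

(** The colon ideal [(P : g)], used to reduce membership of products to
    generators. *)
Lemma ideal_colon P g : is_ideal P -> is_ideal (fun f => P (f * g)).
Proof.
move=> [P0 PD]; split=> [|a f h Pf Ph]; first by rewrite mul0r.
by rewrite mulrDl -mulrA; apply: PD.
Qed.

(** Fixing one factor of a product and taking colon ideals reduces each
    inclusion to elements [f * g * p]. *)
Lemma ideal_mulA I J P :
  same_ideal (ideal_mul (ideal_mul I J) P) (ideal_mul I (ideal_mul J P)).
Proof.
move=> h; split; move: h; apply: ideal_mul_incl; try exact: ideal_gen_ideal.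
- move=> f p IJf Pp; move: f IJf.
  apply: ideal_mul_incl; first exact/ideal_colon/ideal_gen_ideal.
  by move=> f g If Jg; rewrite -mulrA; do 2!apply: ideal_mul_mem => //.
- move=> f h If JPh; rewrite mulrC; move: h JPh.
  apply: ideal_mul_incl; first exact/ideal_colon/ideal_gen_ideal.
  by move=> g p Jg Pp; rewrite mulrC mulrA; do 2!apply: ideal_mul_mem => //.
Qed.

End IdealAlgebra.

(** * Monomial ideals *)
Section MonomialIdeals.
Variables (n : nat) (K : fieldType).
Implicit Types (S T : 'X_{1..n} -> Prop) (I : {mpoly K[n]} -> Prop).

Lemma mpolyX_mem_le S c d :
  S c -> (c <= d)%MM -> monom_gen S ('X_[d] : {mpoly K[n]}).
Proof.
move=> Sc /submK <-; rewrite mpolyXD.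
apply: ideal_mull; first exact: ideal_gen_ideal.
by apply: mem_ideal_gen; exists c.
Qed.

Lemma monom_gen_incl S T :
    (forall d, S d -> exists2 e, T e & (e <= d)%MM) ->
  ideal_incl (monom_gen (K := K) S) (monom_gen T).
Proof.
move=> ST; apply: ideal_gen_incl => _ [d /ST[e Te le_ed] ->].
exact: mpolyX_mem_le le_ed.
Qed.

Lemma monom_gen_mul S T :
  same_ideal (ideal_mul (monom_gen (K := K) S) (monom_gen T))
    (monom_gen (fun d => exists a b, [/\ S a, T b & d = (a + b)%MM])).
Proof.
set ST := fun d => _.
have idST : is_ideal (monom_gen (K := K) ST) by exact: ideal_gen_ideal.
move=> h; split; move: h; last first.
  apply: ideal_gen_min; first exact: ideal_gen_ideal.
  move=> _ [_ [a [b [Sa Tb ->]]] ->]; rewrite mpolyXD.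
  by apply: ideal_mul_mem; apply: mem_ideal_gen; [exists a | exists b].
apply: ideal_mul_incl => // f g Sf Tg; move: f Sf.
apply: ideal_gen_min; first exact: ideal_colon.
move=> _ [a Sa ->]; rewrite mulrC; move: g Tg.
apply: ideal_gen_min; first exact: ideal_colon.
move=> _ [b Tb ->]; rewrite mulrC -mpolyXD; apply: mem_ideal_gen.
by exists (a + b)%MM => //; exists a, b.
Qed.

End MonomialIdeals.

(** * Ideals generated by an antichain of monomials *)

Section Antichains.
Variables (n : nat) (K : fieldType) (N : nat) (e : 'I_N -> 'X_{1..n}).
Hypothesis e_antichain : forall i j, (e i <= e j)%MM -> i = j.
Implicit Types (I : {mpoly K[n]} -> Prop) (f h : {mpoly K[n]}).

Let S (d : 'X_{1..n}) : Prop := exists i, d = e i.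
Let coefs f : 'rV[K]_N := \row_i f@_(e i).

Lemma coefsD f h : coefs (f + h) = coefs f + coefs h.
Proof. by apply/rowP=> i; rewrite !mxE mcoeffD. Qed.

Lemma coefsZ a f : coefs (a *: f) = a *: coefs f.
Proof. by apply/rowP=> i; rewrite !mxE mcoeffZ. Qed.

Lemma coefs0 : coefs 0 = 0.
Proof. by apply/rowP=> i; rewrite !mxE mcoeff0. Qed.

Lemma coefsX j : coefs 'X_[e j] = delta_mx 0 j.
Proof.
apply/rowP=> i; rewrite !mxE mcoeffX eqxx; congr _%:R; congr nat_of_bool.
apply/eqP/eqP=> [eq_e|->//].
by apply/esym/e_antichain; rewrite eq_e lepm_refl.
Qed.

(** Every monomial occurring in an element of the ideal lies above some [e j].
    A monomial of [h] other than [1] pushes it strictly above, where by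
    incomparability there is no [e i]. *)
Lemma coefsM h f : monom_gen S f -> coefs (h * f) = h@_0%MM *: coefs f.
Proof.
move=> Sf; move: f Sf h; apply: ideal_gen_min.
  split=> [h|a f g IHf IHg h]; first by rewrite mulr0 coefs0 scaler0.
  by rewrite mulrDr mulrA !coefsD !IHf IHg scalerDr scalerA -rmorphM.
move=> _ [_ [j ->] ->] h; apply/rowP=> i; rewrite !mxE mcoeffX.
have [eq_ji|ne_ji] := eqVneq (e j) (e i).
  by rewrite -eq_ji mulr1 -[X in _@_X]addm0 mcoeffMX.
rewrite mulr0; apply: memN_msupp_eq0.
apply: contra ne_ji; rewrite (perm_mem (msuppMX _ _)) => /mapP[d _ eq_i].
by apply/eqP; congr e; apply: e_antichain; rewrite eq_i lem_addr.
Qed.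

Lemma antichain_comb f : monom_gen S f ->
  exists h : 'I_N -> {mpoly K[n]}, f = \sum_i h i * 'X_[e i].
Proof.
move: f; apply: ideal_gen_min; first split.
- by exists (fun=> 0); rewrite big1 // => i _; rewrite mul0r.
- move=> a _ _ [h1 ->] [h2 ->]; exists (fun i => a * h1 i + h2 i).
  rewrite mulr_sumr -big_split; apply: eq_bigr => i _.
  by rewrite mulrDl mulrA.
- move=> _ [_ [j ->] ->]; exists (fun i => (i == j)%:R).
  rewrite (bigD1 j) //= eqxx mul1r big1 ?addr0 // => i /negPf->.
  by rewrite mul0r.
Qed.

(** If [g] generates, the coefficient vectors of its members span, by
    [coefsM], the coefficient vectors of the whole ideal, that is all row
    vectors of length [N]; so [g] has at least [N] members. *)
Lemma antichain_mu I : same_ideal I (monom_gen S) -> is_mu I N.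
Proof.
move=> IS; have S_e i : S (e i) by exists i.
split=> [|g gI].
  exists [seq 'X_[e i] | i <- enum 'I_N].
    by rewrite size_map size_enum_ord.
  apply: same_ideal_trans (same_ideal_sym IS); apply: ideal_gen_same => f.
  split=> [/mapP[i _ ->] | [_ [i ->] ->]]; first by exists (e i).
  by apply: map_f; rewrite mem_enum.
pose B : 'M_(size g, N) := \matrix_l coefs g`_l.
have coefs_g f : ideal_gen (fun h => h \in g) f -> (coefs f <= B)%MS.
  move=> [p [a [s [s_g ->]]]]; rewrite (big_morph coefs coefsD coefs0).
  apply: summx_sub => l _; rewrite coefsM; last first.
    exact/IS/gI/mem_ideal_gen.
  apply: scalemx_sub.
  have lt_s : (index (s l) g < size g)%N by rewrite index_mem.
  have <- : row (Ordinal lt_s) B = coefs (s l) by rewrite rowK /= nth_index.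
  exact: row_sub.
have: (1%:M <= B)%MS.
  apply/row_subP=> i; rewrite rowE mulmx1 -coefsX.
  by apply/coefs_g/gI/IS/mem_ideal_gen; exists (e i).
by move/mxrankS; rewrite mxrank1 => /leq_trans; apply; apply: rank_leq_row.
Qed.

Lemma max_graded_coef0 f : max_graded f <-> f@_0%MM = 0.
Proof.
split; last first.
  move=> f0; rewrite [f]mpolyE big_seq; elim/big_ind: _ => [|g h Ig Ih|d df].
  - exact: (ideal_gen_ideal _).1.
  - by rewrite -[g]mul1r; apply: (ideal_gen_ideal _).2.
  have [i lt_i] : exists i, d i != 0%N.
    apply/existsP; apply: contraLR df; rewrite negb_exists => /forallP d0.
    have -> : d = 0%MM by apply/mnmP=> i; rewrite mnm0E; apply/eqP/negPn.
    by rewrite mcoeff_msupp f0 eqxx.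
  rewrite -lep1mP in lt_i; rewrite -mul_mpolyC -(submK lt_i) mpolyXD mulrA.
  apply: ideal_mull; first exact: ideal_gen_ideal.
  by apply: mem_ideal_gen; exists i.
move: f; apply: ideal_gen_min.
  split=> [|a f g f0 g0]; first exact: mcoeff0.
  by rewrite mcoeffD g0 addr0 rmorphM /= f0 mulr0.
move=> _ [i ->]; rewrite mcoeffX; case: eqP => // /mnmP/(_ i).
by rewrite mnm1E eqxx mnm0E.
Qed.

(** The classes of the monomials [e i] form a basis: subtracting the constant
    terms of the coefficients in a combination of the generators leaves
    something in the maximal ideal times [I], and on that product the
    coefficient vector vanishes by [coefsM]. *)
Lemma antichain_dim_quot I :
  same_ideal I (monom_gen S) -> is_dim_quot I (ideal_mul (@max_graded n K) I) N.
Proof.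
move=> IS; have I_e i : I 'X_[e i].
  by apply/IS/mem_ideal_gen; exists (e i) => //; exists i.
exists (fun i => 'X_[e i]); split=> // [f /IS/antichain_comb[h ->]|a].
  exists (fun i => (h i)@_0%MM); rewrite -sumrB; apply: ideal_sum.
    exact: ideal_gen_ideal.
  move=> i; rewrite -mul_mpolyC -mulrBl; apply: ideal_mul_mem => //.
  by apply/max_graded_coef0; rewrite mcoeffB mcoeffC eqxx mulr1 subrr.
set f := \sum_i _ => mIf i.
have <- : coefs f 0 i = a i.
  rewrite (big_morph coefs coefsD coefs0) summxE (bigD1 i) //=.
  rewrite big1 => [|j ne_ji].
    by rewrite coefsZ coefsX !mxE !eqxx mulr1 addr0.
  by rewrite coefsZ coefsX !mxE eq_sym (negPf ne_ji) andbF mulr0.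
suff -> : coefs f = 0 by rewrite mxE.
have Sf g : ideal_mul (@max_graded n K) I g -> monom_gen S g /\ coefs g = 0.
  move: g; apply: ideal_mul_incl => [|g h /max_graded_coef0 g0 /IS Sh].
    have [S0 SD] : is_ideal (monom_gen (K := K) S) by exact: ideal_gen_ideal.
    split=> [|b g h [Sg g0] [Sh h0]]; first by split; rewrite ?coefs0.
    by split; [exact: SD | rewrite coefsD coefsM // g0 h0 scaler0 addr0].
  split; last by rewrite coefsM // g0 scale0r.
  by apply: ideal_mull => //; apply: ideal_gen_ideal.
by have [] := Sf f mIf.
Qed.

End Antichains.

(** * Products of staircase ideals *)

Section StaircasePowers.
Variables (n : nat) (K : fieldType) (c : nat -> 'X_{1..n}) (N : nat).
Hypothesis c_concave :
  forall i, (i.+2 <= N)%N -> (c i + c i.+2 <= c i.+1 *+ 2)%MM.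

(** With [T] all of [c] this computes [I I^k], and with [T] the two ends it
    computes [J I^k]. Two ends suffice once [k > 0], because a point of the
    first round of [stair k.+1] is then [c 0] plus a point of [stair k]. *)
Lemma stairs_mul (T : 'X_{1..n} -> Prop) (k : nat) :
    (forall d, T d -> exists2 i, (i <= N)%N & d = c i) -> T (c 0) -> T (c N) ->
    ((0 < k)%N \/ forall i, (i <= N)%N -> T (c i)) ->
  same_ideal (ideal_mul (monom_gen (K := K) T) (monom_gen (stairs c N k)))
    (monom_gen (stairs c N k.+1)).
Proof.
move=> Tc T0 TN kT; apply: same_ideal_trans (monom_gen_mul _ _) _ => f.
split; move: f; apply: monom_gen_incl => d.
  move=> [_ [_ [/Tc[i le_i ->] [s le_s ->] ->]]].
  exists (stair c N k.+1 (i + s)).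
    by exists (i + s)%N => //; rewrite mulnS leq_add.
  exact: stair_le_add.
move=> [t le_t ->]; exists (stair c N k.+1 t); last exact: lepm_refl.
have [le_tN | lt_Nt] := leqP t N; last first.
  rewrite -(subnKC (ltnW lt_Nt)) stair_shift.
  exists (c N), (stair c N k (t - N)).
  by split=> //; exists (t - N)%N => //; rewrite mulnS in le_t; lia.
case: kT => [|TcN].
  case: k le_t => // k le_t _; exists (c 0%N), (stair c N k.+1 t); split=> //.
    by exists t => //; rewrite mulnS; lia.
  by rewrite !stair_init // mulmS addmA [(c t + _)%MM]addmC -addmA.
exists (c t), (stair c N k 0); rewrite stair_init // stair0.
by split=> //; [exact: TcN | exists 0%N; rewrite ?stair0].
Qed.

End StaircasePowers.

(** * Minimal generators in two variables *)

Lemma min_gens_antichain (n : nat) (K : fieldType) (I : {mpoly K[n]} -> Prop)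
    (u : seq 'X_{1..n}) (c d : 'X_{1..n}) :
  min_monom_gens I u -> c \in u -> d \in u -> (d <= c)%MM -> d = c.
Proof.
move=> [Iu u_min] cu du le_dc; apply/eqP/negPn/negP=> ne_dc.
(* If [d] divides [c] properly, [c] can be dropped from the generators. *)
suff Iv : same_ideal I (monom_gen (fun b => b \in [seq b <- u | b != c])).
  have sub_vu : {subset [seq b <- u | b != c] <= u}.
    exact/mem_subseq/filter_subseq.
  by have := u_min _ sub_vu Iv c cu; rewrite mem_filter eqxx.
apply: same_ideal_trans Iu _ => f.
split; move: f; apply: monom_gen_incl => b; last first.
  by rewrite mem_filter => /andP[_ bu]; exists b; rewrite ?lepm_refl.
move=> bu; have [->|ne_bc] := eqVneq b c.
  by exists d; rewrite // mem_filter ne_dc.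
by exists b; rewrite ?lepm_refl // mem_filter ne_bc.
Qed.

Lemma lex_gt2 (c d : 'X_{1..2}) : lex_gt c d ->
  (d ord0 < c ord0)%N \/ (c ord0 = d ord0 /\ d ord_max < c ord_max)%N.
Proof.
move=> /existsP[[[|[|s]] lt_i] /andP[lt_dc /forallP eq_cd]] //.
  by left; have <- : Ordinal lt_i = ord0 by apply: val_inj.
right; have <- : Ordinal lt_i = ord_max by apply: val_inj.
by split=> //; apply/eqP/(implyP (eq_cd ord0)).
Qed.

Lemma lepm2 (c d : 'X_{1..2}) :
  (c ord0 <= d ord0)%N -> (c ord_max <= d ord_max)%N -> (c <= d)%MM.
Proof.
move=> le0 le1; apply/mnm_lepP=> -[[|[|s]] lt_i] //.
  by have -> : Ordinal lt_i = ord0 by apply: val_inj.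
by have -> : Ordinal lt_i = ord_max by apply: val_inj.
Qed.

(** Lexicographic order lets the first coordinate decrease or stay; if it
    stays, or if the second coordinate does not increase, the two generators
    are comparable, against minimality. *)
Lemma min_gens_step (K : fieldType) (I : {mpoly K[2]} -> Prop)
    (u : seq 'X_{1..2}) (s : nat) :
    is_G I u -> (s.+1 < size u)%N ->
  (nth 0%MM u s.+1 ord0 < nth 0%MM u s ord0)%N /\
  (nth 0%MM u s ord_max < nth 0%MM u s.+1 ord_max)%N.
Proof.
move=> [u_min /(sortedP 0%MM)/(_ s) lex_u] lt_s.
have us : nth 0%MM u s \in u by rewrite mem_nth // ltnW.
have uS : nth 0%MM u s.+1 \in u by rewrite mem_nth.
have anti := min_gens_antichain u_min us uS.
have ne_u : nth 0%MM u s.+1 <> nth 0%MM u s.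
  move=> eq_u; have := lex_gt2 (lex_u lt_s).
  by rewrite eq_u !ltnn; case=> // -[].
have := lex_gt2 (lex_u lt_s).
case=> [lt_a | [eq_a lt_b]]; last first.
  by case: ne_u; apply/anti/lepm2; rewrite ?eq_a // ltnW.
split=> //; rewrite ltnNge; apply/negP=> le_b.
by case: ne_u; apply/anti/lepm2 => //; apply: ltnW.
Qed.

(** The zero ideal is prime and properly contains no prime ideal, so its height
    is [0]. *)
Lemma height2_neq0 (K : fieldType) (I : {mpoly K[2]} -> Prop) :
  has_height I 2 -> ~ same_ideal I (fun f => f = 0).
Proof.
move=> [ht_I _] I0; have: prime_height_ge (fun f : {mpoly K[2]} => f = 0) 2.
  apply: ht_I => [|f /I0//]; split=> [|/eqP|f g /eqP].
  - by split=> // a f g -> ->; rewrite mulr0 addr0.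
  - by rewrite oner_eq0.
  - by rewrite mulf_eq0 => /orP[]/eqP; [left | right].
move=> [Q [Q_prime Q_chain Q2]]; have [_ []] := Q_chain 1%N isT.
by move=> f /Q2 ->; have [[]] := Q_prime 1%N isT.
Qed.

(** * The Hilbert series and the theorem *)

Lemma Hilbert_series_line (m : nat) : (0 < m)%N ->
  series_eq_frac (fun k => ((m - 1) * k + 1)%N%:Z)
    (1 + (m%:Z - 2)%:P * 'X) ((1 - 'X) ^+ 2).
Proof.
case: m => // m _; set q := (1 - 'X) ^+ 2.
have qE j : q`_j = (j == 0%N)%:R - (j == 1%N)%:R *+ 2 + (j == 2%N)%:R.
  have -> : q = 1 - 'X *+ 2 + 'X^2 by rewrite /q; ring.
  by rewrite !(coefD, coefN, coefMn, coefX, coefXn, coef1).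
rewrite subn1 /=; move=> [|[|k]].
- rewrite big_ord_recr big_ord0 /= qE.
  by rewrite !(coefD, coefC, coefCM, coefX, coef1) /=; lia.
- rewrite !big_ord_recr big_ord0 /= !qE.
  by rewrite !(coefD, coefC, coefCM, coefX, coef1) /=; lia.
rewrite !big_ord_recr big1 /= => [|i _]; last first.
  rewrite qE; have -> : (k.+2 - i = (k - i.+1).+3)%N by have := ltn_ord i; lia.
  by rewrite mulr0.
rewrite !qE !(coefD, coefC, coefCM, coefX, coef1) /=.
have -> : (k.+2 - k = 2)%N by lia.
have -> : (k.+2 - k.+1 = 1)%N by lia.
rewrite subnn /=; lia.
Qed.

Theorem proposition2p1 (K : fieldType) (I : {mpoly K[2]} -> Prop)
    (m : nat) (u : m.-tuple 'X_{1..2})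
    (I_monomial : monomial_ideal I)
    (I_height : has_height I 2)
    (u_gens : is_G I u)
    (I_concave : concave u) :
  let J : {mpoly K[2]} -> Prop :=
    ideal_gen (fun f => f = 'X_[nth 0%MM u 0] \/ f = 'X_[nth 0%MM u m.-1]) in
  (forall k : nat, (2 <= k)%N ->
     same_ideal (ideal_exp I k) (ideal_mul (ideal_exp J k.-1) I) /\
     same_ideal (ideal_exp I k) (ideal_mul J (ideal_exp I k.-1))) /\
  (forall k : nat, is_mu (ideal_exp I k) ((m - 1) * k + 1)%N) /\
  (exists2 H : nat -> nat, is_fiber_Hilbert_fun I H &
     series_eq_frac (fun k => (H k)%:Z)
       (1 + (m%:Z - 2)%:P * 'X) ((1 - 'X) ^+ 2)).
Proof.
have [u_min _] := u_gens.
have m_gt0 : (0 < m)%N.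
  case: m u {I_concave u_gens} u_min => // u u_min.
  case: (height2_neq0 I_height).
  apply: same_ideal_trans u_min.1 _; rewrite tuple0 => f.
  split=> [|->]; last exact: (ideal_gen_ideal _).1.
  move: f; apply: ideal_gen_min => [|f [c]//]; split=> // a f g -> ->.
  by rewrite mulr0 addr0.
move=> J; pose c s := nth 0%MM u s; pose N := m.-1.
have size_u : size u = N.+1 by rewrite size_tuple prednK.
pose T d := exists2 i, (i <= N)%N & d = c i.
have I_T : same_ideal I (monom_gen T).
  apply: same_ideal_trans u_min.1 _; apply: ideal_gen_same => f.
  split=> -[d].
    move=> /(nthP 0%MM)[i]; rewrite size_u => lt_i <- ->.
    by exists (c i) => //; exists i.
  by move=> [i le_i ->] ->; exists (c i) => //; rewrite mem_nth ?size_u.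
pose E d := d = c 0 \/ d = c N.
have J_E : same_ideal J (monom_gen E).
  apply: ideal_gen_same => f; split=> [[]-> | [d [] -> ->]].
  - by exists (c 0) => //; left.
  - by exists (c N) => //; right.
  - by left.
  - by right.
have cC i : (i.+2 <= N)%N -> (c i + c i.+2 <= c i.+1 *+ 2)%MM.
  by move=> le_i; apply: I_concave; rewrite size_u.
pose M k : {mpoly K[2]} -> Prop := monom_gen (stairs c N k).
have I_mul k : same_ideal (ideal_mul I (M k)) (M k.+1).
  apply: same_ideal_trans (ideal_mul_same I_T (same_ideal_refl _)) _.
  apply: stairs_mul => //; [by exists 0%N | by exists N | right=> i le_i].
  by exists i.
have J_mul k : (0 < k)%N -> same_ideal (ideal_mul J (M k)) (M k.+1).
  move=> k_gt0.
  apply: same_ideal_trans (ideal_mul_same J_E (same_ideal_refl _)) _.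
  apply: stairs_mul => //; [ | by left | by right | by left].
  by move=> d [] ->; [exists 0%N | exists N].
have I_exp k : same_ideal (ideal_exp I k) (M k).
  elim: k => [|k IHk] /=; last first.
    apply: same_ideal_trans (I_mul k).
    exact: ideal_mul_same (same_ideal_refl _) IHk.
  move=> f; split=> // _; rewrite -[f]mulr1 -mpolyX0.
  apply: ideal_mull; first exact: ideal_gen_ideal.
  by apply: mem_ideal_gen; exists 0%MM => //; exists 0%N.
have JI_exp k : same_ideal (ideal_mul (ideal_exp J k) I) (M k.+1).
  elim: k => [|k IHk] /=.
    exact: same_ideal_trans (@ideal_mulC _ _ _) (I_exp 1%N).
  apply: same_ideal_trans (@ideal_mulA _ _ _ _) _.
  apply: same_ideal_trans (J_mul k.+1 isT).
  exact: ideal_mul_same (same_ideal_refl _) IHk.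
have decr l : (l < N)%N -> (c l.+1 ord0 < c l ord0)%N.
  by move=> lt_l; have [] := min_gens_step (s := l) u_gens; rewrite ?size_u.
have incr l : (l < N)%N -> (c l ord_max < c l.+1 ord_max)%N.
  by move=> lt_l; have [] := min_gens_step (s := l) u_gens; rewrite ?size_u.
pose e k (i : 'I_(N * k).+1) := stair c N k i.
have e_anti k i j : (e k i <= e k j)%MM -> i = j.
  move=> le_ij; apply: val_inj; apply: (stair_antichain decr incr _ _ le_ij);
    exact: leq_ord.
have I_e k :
    same_ideal (ideal_exp I k) (monom_gen (fun d => exists i, d = e k i)).
  apply: same_ideal_trans (I_exp k) _; apply: ideal_gen_same => f.
  split=> -[d]; last first.
    move=> [i ->] ->; exists (e k i) => //.
    by exists (i : nat) => //; apply: leq_ord.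
  move=> [s le_s ->] ->; exists (stair c N k s) => //.
  by rewrite -ltnS in le_s; exists (Ordinal le_s).
have -> : (m - 1 = N)%N by rewrite subn1.
split=> [[//|k] k_gt1 /=|].
  split; last first.
    apply: same_ideal_trans (I_exp k.+1) (same_ideal_sym _).
    apply: same_ideal_trans (J_mul k k_gt1).
    exact: ideal_mul_same (same_ideal_refl _) (I_exp k).
  exact: same_ideal_trans (I_exp k.+1) (same_ideal_sym (JI_exp k)).
split=> [k|].
  by rewrite addn1; exact: (antichain_mu (e_anti k) (I_e k)).
exists (fun k => ((m - 1) * k + 1)%N); last exact: Hilbert_series_line.
move=> k; rewrite subn1 addn1.
exact: (antichain_dim_quot (e_anti k) (I_e k)).
Qed.
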